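(* Let $R>0$ and let $\mathbf{x}$ be a generalized equi-centro-affine extremal curve on the sphere of radius $R$ with constants $C_1,C_2$ and with $B=\kappa_g^{-2/3}$ nonconstant. Suppose that $\frac{B^3}{R^2}-C_1B^2-C_2B+4=0$ admits two distinct positive roots $A_1>A_2$. Then the progression angle $\Lambda^\Theta$ of $\mathbf{x}$ within one period of the curvature is $$\Lambda^\Theta=2\sqrt{\frac{4C_2}{R^2}+C_1^2}\int_{A_2}^{A_1}\frac{B^{-\frac12}}{(C_2-B^2/R^2+C_1B)\sqrt{C_2-B^2/R^2-4B^{-1}+C_1B}}\,dB .$$
   Context: A curve on the sphere of radius $R$ in $\mathbb{R}^3$ with nowhere vanishing geodesic curvature, oriented so that $\kappa_g>0$, with Euclidean arc length $s$, is a generalized equi-centro-affine extremal curve if $B=\kappa_g^{-2/3}$ satisfies $B_{ss}-2B^{-2}+R^{-2}B=\frac{C_1}{2}$ for a constant $C_1$. Integrating once gives $B_s^2=C_2-\frac{B^2}{R^2}-4B^{-1}+C_1B$ with an integration constant $C_2$. If $B$ is nonconstant, $B$ oscillates periodically between $A_2$ and $A_1$. The vector field $\mathbf{J}=-2B^{-1/2}\mathbf{T}+B_s\boldsymbol\epsilon$ along the curve ($\mathbf T$ the unit tangent, $\boldsymbol\epsilon$ the unit normal in the sphere with $\nabla_{\mathbf T}\mathbf T=\kappa_g\boldsymbol\epsilon$) is the restriction of a Killing field of the sphere, i.e. an infinitesimal rotation about an axis. The progression angle $\Lambda^\Theta$ is the absolute value of the change of the azimuthal angle about this axis along the curve over one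 period of $B$ (equivalently of $\kappa_g$). *)

(* Defs.v *)
From Stdlib Require Import Reals Lra.
From Coquelicot Require Import Coquelicot.
Open Scope R_scope.

Notation vec := (R * R * R)%type.

Definition c1 (u : vec) : R := fst (fst u).
Definition c2 (u : vec) : R := snd (fst u).
Definition c3 (u : vec) : R := snd u.

Definition dot (u v : vec) : R := c1 u * c1 v + c2 u * c2 v + c3 u * c3 v.

Definition cross (u v : vec) : vec :=
  (c2 u * c3 v - c3 u * c2 v, c3 u * c1 v - c1 u * c3 v, c1 u * c2 v - c2 u * c1 v).

Definition vDerive (u : R -> vec) (s : R) : vec :=
  (Derive (fun t => c1 (u t)) s, Derive (fun t => c2 (u t)) s, Derive (fun t => c3 (u t)) s).

(* [ex_derive_n f n] says nothing about the orders below [n], hence the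
   quantification over all [k <= n]. *)
Definition times_differentiable (n : nat) (u : R -> vec) : Prop :=
  forall (k : nat) (s : R), (k <= n)%nat ->
    ex_derive_n (fun t => c1 (u t)) k s /\
    ex_derive_n (fun t => c2 (u t)) k s /\
    ex_derive_n (fun t => c3 (u t)) k s.

Definition tangent (x : R -> vec) : R -> vec := vDerive x.

(* Levi-Civita derivative, on the sphere of radius [r] centred at the origin,
   of a tangent field [v] along [x]: the tangential part of its derivative. *)
Definition nabla (r : R) (x v : R -> vec) (s : R) : vec :=
  minus (vDerive v s) (scal (dot (vDerive v s) (x s) / r ^ 2) (x s)).

(* The sphere is oriented by its outward normal [x / r]. *)
Definition normal (r : R) (x : R -> vec) (s : R) : vec :=
  scal (/ r) (cross (x s) (tangent x s)).

Definition kappa_g (r : R) (x : R -> vec) (s : R) : R :=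
  dot (nabla r x (tangent x) s) (normal r x s).

Definition Bfun (r : R) (x : R -> vec) (s : R) : R :=
  Rpower (kappa_g r x s) (- 2 / 3).

(* Reversing the curve changes the sign of [kappa_g], so that [0 < kappa_g] is
   a choice of orientation for a curve with nowhere vanishing curvature.
   Four derivatives are what [Derive_n (Bfun r x) 2] requires. *)
Definition positively_curved_spherical_curve (r : R) (x : R -> vec) : Prop :=
  times_differentiable 4 x /\
  (forall s, dot (x s) (x s) = r ^ 2) /\
  (forall s, dot (tangent x s) (tangent x s) = 1) /\
  (forall s, 0 < kappa_g r x s).

Definition extremal_curve (r C1 : R) (x : R -> vec) : Prop :=
  positively_curved_spherical_curve r x /\
  forall s, Derive_n (Bfun r x) 2 s - 2 * / (Bfun r x s) ^ 2 + / r ^ 2 * Bfun r x s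
            = C1 / 2.

Definition first_integral (r C1 C2 : R) (x : R -> vec) : Prop :=
  forall s, (Derive (Bfun r x) s) ^ 2
            = C2 - (Bfun r x s) ^ 2 / r ^ 2 - 4 * / Bfun r x s + C1 * Bfun r x s.

Definition Jfield (r : R) (x : R -> vec) (s : R) : vec :=
  plus (scal (- 2 * Rpower (Bfun r x s) (- 1 / 2)) (tangent x s))
       (scal (Derive (Bfun r x) s) (normal r x s)).

(* The Killing fields of the sphere are the fields [p |-> cross w p]; for
   [w <> 0] the axis of this infinitesimal rotation is the line spanned by [w]. *)
Definition rotation_vector (r : R) (x : R -> vec) (w : vec) : Prop :=
  w <> zero /\ forall s, Jfield r x s = cross w (x s).

Definition orthonormal_basis_of_orthogonal (w e1 e2 : vec) : Prop :=
  dot e1 e1 = 1 /\ dot e2 e2 = 1 /\ dot e1 e2 = 0 /\ dot e1 w = 0 /\ dot e2 w = 0.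

(* [rho] is the distance to the axis; the curve is thus required to avoid the
   axis, which makes the continuous angle [theta] unique up to [2 * PI * k]. *)
Definition azimuth (e1 e2 : vec) (x : R -> vec) (theta : R -> R) : Prop :=
  (forall s, continuous theta s) /\
  forall s, exists rho : R, 0 < rho /\
    dot (x s) e1 = rho * cos (theta s) /\ dot (x s) e2 = rho * sin (theta s).

Definition least_period (f : R -> R) (P : R) : Prop :=
  0 < P /\ (forall s, f (s + P) = f s) /\
  forall Q, 0 < Q -> (forall s, f (s + Q) = f s) -> P <= Q.

Definition progression_data (r : R) (x : R -> vec)
    (P : R) (w e1 e2 : vec) (theta : R -> R) : Prop :=
  least_period (Bfun r x) P /\ rotation_vector r x w /\
  orthonormal_basis_of_orthogonal w e1 e2 /\ azimuth e1 e2 x theta.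

(* The period, the axis and an azimuth exist, and whatever the choice of the
   azimuth and of the starting point, the change over one period is [L] in
   absolute value. *)
Definition is_progression_angle (r : R) (x : R -> vec) (L : R) : Prop :=
  (exists P w e1 e2 theta, progression_data r x P w e1 e2 theta) /\
  forall P w e1 e2 theta, progression_data r x P w e1 e2 theta ->
    forall s0, Rabs (theta (s0 + P) - theta s0) = L.

Definition progression_integrand (r C1 C2 b : R) : R :=
  Rpower b (- 1 / 2) /
  ((C2 - b ^ 2 / r ^ 2 + C1 * b) *
   sqrt (C2 - b ^ 2 / r ^ 2 - 4 * / b + C1 * b)).

(* Main.v *)
From Stdlib Require Import Reals Lra Lia.
From Coquelicot Require Import Coquelicot.
(* Imported last: [Reals] also exports names [c1] and [c2]. *)
Require Import Defs.
Open Scope R_scope.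

(** Let [T], [eps] be the unit tangent and the unit normal in the sphere and
    [b = B^(-1/2) = kappa_g^(1/3)]. Since [T' = - x / r^2 + kappa_g eps] and
    [eps' = - kappa_g T], the equation of [B] says exactly that
    [w = - (2 b / r) eps - (B' / r) T + ((C1 / 2 - B / r^2) / r) x] is constant;
    moreover [J = w * x] (cross product), [|w|^2 = C2 / r^2 + C1^2 / 4], and the
    squared distance to the axis times [|w|^2] is [|J|^2 = 4 / B + B'^2 = G (B)]
    with [G b = C2 - b^2 / r^2 + C1 b]. Pairing [J] with [T] gives the speed
    [theta' = - 2 lam B^(-1/2) / G (B)] of the azimuth, where [lam = |w|] or [- |w|].

    The cubic has a third root [- D < 0], so [B'^2 = (A1 - B) (B - A2) q(B)^2]
    with [q b = sqrt ((b + D) / (r^2 b))] smooth and positive. Hence [(B, B')] moves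
    on a circle after rescaling: [B = (A1 + A2) / 2 - (A1 - A2) / 2 * cos phi] with
    [phi' = q (B)]. One period of [B] is one turn of [phi], the integral of [theta']
    over it is twice the integral over a half turn, and substituting
    [b = (A1 + A2) / 2 - (A1 - A2) / 2 * cos phi] turns that one into the
    improper integral of the statement. *)

(** * Angles of plane curves *)

Lemma null_derivative_constant (f : R -> R) :
  (forall s, is_derive f s 0) -> forall a b, f a = f b.
Proof.
intros H a b.
destruct (Rtotal_order a b) as [h | [h | h]].
- apply (eq_is_derive f a b); auto.
- now subst.
- symmetry; apply (eq_is_derive f b a); auto.
Qed.

Lemma is_derive_value (f : R -> R) (x l l' : R) :
  is_derive f x l -> l = l' -> is_derive f x l'.
Proof. now intros h <-. Qed.

Lemma positive_derivative_incr (f df : R -> R) :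
  (forall s, is_derive f s (df s)) -> (forall s, 0 < df s) ->
  forall a b, a < b -> f a < f b.
Proof.
intros H hpos a b hab.
destruct (MVT_gen f a b df) as [c [_ hc]].
- intros; apply H.
- intros y _; apply continuity_pt_filterlim, (ex_derive_continuous f).
  eexists; apply H.
- assert (0 < df c * (b - a)) by (apply Rmult_lt_0_compat; [apply hpos | lra]).
  lra.
Qed.

Lemma is_derive_RInt_from_0 (f : R -> R) :
  (forall x, continuous f x) -> forall x, is_derive (fun y => RInt f 0 y) x (f x).
Proof.
intros H x.
apply (is_derive_RInt f (fun y => RInt f 0 y) 0 x); [ | apply H].
apply filter_forall; intros y; apply (RInt_correct f).
apply (ex_RInt_continuous f); intros; apply H.
Qed.

Lemma angle_exists (u v : R) :
  u ^ 2 + v ^ 2 = 1 -> exists t, u = cos t /\ v = sin t.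
Proof.
intros H.
assert (hu : -1 <= u <= 1) by nra.
assert (hs : sqrt (1 - u²) = Rabs v).
{ replace (1 - u²) with (v²) by (unfold Rsqr; lra). apply sqrt_Rsqr_abs. }
destruct (Rle_dec 0 v) as [hv | hv].
- exists (acos u); rewrite cos_acos, sin_acos, hs, Rabs_right; lra.
- exists (- acos u).
  rewrite cos_neg, sin_neg, cos_acos, sin_acos, hs, Rabs_left; lra.
Qed.

(** [auto_derive] leaves terms [Derive f s] for abstract [f]; this replaces them by the value that
    the hypothesis [H] provides. *)
Ltac rewrite_derive H :=
  match type of H with
  | forall s, is_derive ?f s _ =>
      rewrite ?(is_derive_unique (fun y => f y) _ _ (H _))
  end.

Ltac solve_derive_side :=
  repeat match goal with
  | |- _ /\ _ => split
  | H : forall s, is_derive ?f s _ |- ex_derive ?f _ => exact (ex_intro _ _ (H _))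
  | H : forall s, is_derive ?f s _ |- ex_derive (fun y => ?f y) _ =>
      exact (ex_intro _ _ (H _))
  | |- True => exact I
  end.

(** [Th] has the derivative of the angle of [(X, Y)], so turning the unit vector [(X, Y) / rho] back
    by [Th] gives a vector [(U, V)] with zero derivative. The angle of this constant vector is the
    offset [t0]. *)
Lemma polar_lift (X Y X' Y' Th : R -> R) :
  (forall s, is_derive X s (X' s)) -> (forall s, is_derive Y s (Y' s)) ->
  (forall s, 0 < X s ^ 2 + Y s ^ 2) ->
  (forall s, is_derive Th s ((X s * Y' s - Y s * X' s) / (X s ^ 2 + Y s ^ 2))) ->
  exists t0, forall s,
    X s = sqrt (X s ^ 2 + Y s ^ 2) * cos (Th s + t0) /\
    Y s = sqrt (X s ^ 2 + Y s ^ 2) * sin (Th s + t0).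
Proof.
intros hX hY hpos hTh.
pose (rho := fun s => sqrt (X s ^ 2 + Y s ^ 2)).
assert (hrho : forall s, 0 < rho s) by (intros s; apply sqrt_lt_R0, hpos).
assert (hrho2 : forall s, rho s ^ 2 = X s ^ 2 + Y s ^ 2).
{ intros s; unfold rho; rewrite pow2_sqrt; [ easy | apply Rlt_le, hpos]. }
assert (drho : forall s, is_derive rho s ((X s * X' s + Y s * Y' s) / rho s)).
{ intros s; unfold rho.
  auto_derive.
  - solve_derive_side.
    generalize (hpos s); simpl; lra.
  - rewrite_derive hX; rewrite_derive hY.
    generalize (hrho s); unfold rho; simpl; intros; field.
    simpl in *; lra. }
pose (U := fun s => (X s * cos (Th s) + Y s * sin (Th s)) / rho s).
pose (V := fun s => (Y s * cos (Th s) - X s * sin (Th s)) / rho s).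
assert (dU : forall s, is_derive U s 0).
{ intros s; unfold U; auto_derive.
  - solve_derive_side.
    generalize (hrho s); lra.
  - rewrite_derive hX; rewrite_derive hY; rewrite_derive hTh; rewrite_derive drho.
    rewrite <- hrho2.
    generalize (hrho s) (hrho2 s); intros h1 h2.
    field_simplify_eq; [ | lra].
    replace (rho s ^ 3) with (rho s * rho s ^ 2) by ring.
    rewrite h2; ring. }
assert (dV : forall s, is_derive V s 0).
{ intros s; unfold V; auto_derive.
  - solve_derive_side.
    generalize (hrho s); lra.
  - rewrite_derive hX; rewrite_derive hY; rewrite_derive hTh; rewrite_derive drho.
    rewrite <- hrho2.
    generalize (hrho s) (hrho2 s); intros h1 h2.
    field_simplify_eq; [ | lra].
    replace (rho s ^ 3) with (rho s * rho s ^ 2) by ring.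
    rewrite h2; ring. }
assert (hcs : forall s, sin (Th s) ^ 2 + cos (Th s) ^ 2 = 1).
{ intros s; generalize (sin2_cos2 (Th s)); unfold Rsqr; lra. }
destruct (angle_exists (U 0) (V 0)) as [t0 [hU hV]].
{ unfold U, V. generalize (hrho 0) (hrho2 0) (hcs 0); intros h1 h2 h3.
  transitivity ((X 0 ^ 2 + Y 0 ^ 2) * (sin (Th 0) ^ 2 + cos (Th 0) ^ 2) / rho 0 ^ 2).
  - field; lra.
  - rewrite h3, h2; field. generalize (hpos 0); lra. }
exists t0; intros s; fold (rho s).
rewrite cos_plus, sin_plus, <- hU, <- hV,
  (null_derivative_constant U dU 0 s), (null_derivative_constant V dV 0 s).
generalize (hrho s) (hcs s); intros h1 h3.
unfold U, V; split.
- transitivity (X s * (sin (Th s) ^ 2 + cos (Th s) ^ 2)); [rewrite h3; ring | field; lra].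
- transitivity (Y s * (sin (Th s) ^ 2 + cos (Th s) ^ 2)); [rewrite h3; ring | field; lra].
Qed.

(** The sine of [t1 - t2] vanishes everywhere, so this continuous difference only takes values in
    the multiples of [PI] and must be constant. *)
Lemma polar_angle_unique (X Y r1 r2 t1 t2 : R -> R) :
  (forall s, 0 < r1 s) -> (forall s, 0 < r2 s) ->
  (forall s, X s = r1 s * cos (t1 s) /\ Y s = r1 s * sin (t1 s)) ->
  (forall s, X s = r2 s * cos (t2 s) /\ Y s = r2 s * sin (t2 s)) ->
  (forall s, continuous t1 s) -> (forall s, continuous t2 s) ->
  forall a b, t1 b - t1 a = t2 b - t2 a.
Proof.
intros hr1 hr2 h1 h2 ht1 ht2 a b.
pose (d := fun s => t1 s - t2 s).
assert (hd : forall s, sin (d s) = 0).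
{ intros s; unfold d; rewrite sin_minus.
  destruct (h1 s) as [e1 e2], (h2 s) as [e3 e4].
  apply (Rmult_eq_reg_l (r1 s * r2 s)).
  2: { apply Rmult_integral_contrapositive; generalize (hr1 s) (hr2 s); lra. }
  transitivity ((r1 s * sin (t1 s)) * (r2 s * cos (t2 s))
                - (r1 s * cos (t1 s)) * (r2 s * sin (t2 s))); [ring | ].
  rewrite <- e1, <- e2, <- e3, <- e4; ring. }
assert (hcont : forall s, continuity_pt d s).
{ intros s; apply (continuity_pt_minus t1 t2); apply continuity_pt_filterlim;
    [apply ht1 | apply ht2]. }
assert (key : d a = d b).
{ destruct (Req_dec (d a) (d b)) as [ | hne]; [easy | exfalso].
  (* If [d] varied, it would take a value at distance [e] from [d a]. Since [0 < e <= 1 < PI], the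
     sine of [e] is positive, whereas the sine of [d] vanishes at both values. *)
  pose (e := Rmin 1 (Rabs (d b - d a))).
  assert (he : 0 < e <= 1).
  { unfold e; split; [ | apply Rmin_l].
    apply Rmin_glb_lt; [lra | apply Rabs_pos_lt; lra]. }
  assert (he' : e <= Rabs (d b - d a)) by apply Rmin_r.
  pose (y := if Rle_dec (d a) (d b) then d a + e else d a - e).
  destruct (IVT_gen d a b y) as [c [_ hc]].
  - exact hcont.
  - unfold y, Rmin, Rmax; destruct (Rle_dec (d a) (d b)) as [h | h].
    + rewrite Rabs_right in he'; lra.
    + rewrite Rabs_left in he'; lra.
  - generalize (hd c) (sin_gt_0 e) PI2_1; intros h3 h4 h5.
    assert (h6 : cos (d a) <> 0).
    { generalize (sin2_cos2 (d a)) (hd a); unfold Rsqr; intros; nra. }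
    assert (h7 : sin e = 0).
    { apply (Rmult_eq_reg_l (cos (d a))); [ | easy].
      rewrite hc in h3; unfold y in h3.
      destruct (Rle_dec (d a) (d b)); [rewrite sin_plus in h3 | rewrite sin_minus in h3];
        rewrite hd in h3; lra. }
    lra. }
unfold d in key; lra.
Qed.


Lemma cos_eq_1_ge_2PI (y : R) : 0 < y -> cos y = 1 -> 2 * PI <= y.
Proof.
intros hy hc.
destruct (Rle_dec (2 * PI) y) as [ | h]; [easy | exfalso].
assert (hs : 0 < sin (y / 2)) by (apply sin_gt_0; lra).
replace y with (2 * (y / 2)) in hc by field.
rewrite cos_2a_sin in hc; nra.
Qed.

(** * The angular variable between the turning points *)

(** The difference of the integrals up to [x + p] and up to [x] has derivative zero in [x]; it is
    evaluated at 0. *)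
Lemma RInt_periodic_shift (f : R -> R) (p : R) :
  (forall x, continuous f x) -> (forall x, f (x + p) = f x) ->
  forall x, RInt f 0 (x + p) = RInt f 0 x + RInt f 0 p.
Proof.
intros hc hp x.
pose proof (is_derive_RInt_from_0 f hc) as hF.
assert (h : forall s, is_derive (fun y => RInt f 0 (y + p) - RInt f 0 y) s 0).
{ intros s.
  apply (is_derive_value _ _ (minus (scal 1 (f (s + p))) (f s))).
  2: { rewrite hp; unfold minus, plus, opp, scal; simpl; unfold mult; simpl; ring. }
  apply (is_derive_minus (fun y => RInt f 0 (y + p)) (fun y => RInt f 0 y));
    [ | apply hF].
  apply (is_derive_comp (fun y => RInt f 0 y) (fun y => y + p)); [apply hF | ].
  auto_derive; [easy | ring]. }
generalize (null_derivative_constant _ h x 0); simpl.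
rewrite Rplus_0_l, (RInt_point 0 f); unfold zero; simpl; lra.
Qed.

(** By symmetry about [p], the sum of the integrals up to [p + y] and up to [p - y] does not depend
    on [y]; compare [y = p] with [y = 0]. *)
Lemma RInt_even_periodic (f : R -> R) (p : R) :
  (forall x, continuous f x) -> (forall x, f (p + x) = f (p - x)) ->
  RInt f 0 (2 * p) = 2 * RInt f 0 p.
Proof.
intros hc hp.
pose proof (is_derive_RInt_from_0 f hc) as hF.
assert (h : forall s, is_derive (fun y => RInt f 0 (p + y) + RInt f 0 (p - y)) s 0).
{ intros s.
  apply (is_derive_value _ _ (plus (scal 1 (f (p + s))) (scal (-1) (f (p - s))))).
  2: { rewrite hp; unfold plus, scal; simpl; unfold mult; simpl; ring. }
  apply (is_derive_plus (fun y => RInt f 0 (p + y)) (fun y => RInt f 0 (p - y))).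
  - apply (is_derive_comp (fun y => RInt f 0 y) (fun y => p + y)); [apply hF | ].
    auto_derive; [easy | ring].
  - apply (is_derive_comp (fun y => RInt f 0 y) (fun y => p - y)); [apply hF | ].
    auto_derive; [easy | ring]. }
generalize (null_derivative_constant _ h p 0); simpl.
replace (p - p) with 0 by ring; replace (p + p) with (2 * p) by ring.
rewrite Rplus_0_r, Rminus_0_r, (RInt_point 0 f); unfold zero; simpl; lra.
Qed.

Lemma is_derive_acos (y : R) :
  -1 < y < 1 -> is_derive acos y (- 1 / sqrt (1 - y²)).
Proof.
intros hy; apply is_derive_Reals.
rewrite <- (derive_pt_acos y hy).
apply (derive_pt_eq_1 acos y _ (derivable_pt_acos y hy)); reflexivity.
Qed.

Section Oscillation.

Variables r A1 A2 : R.
Hypotheses (hr : 0 < r) (hA2 : 0 < A2) (hA : A2 < A1).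

(** The three roots of the cubic have product [- 4 * r ^ 2], so the remaining root is the opposite
    of this positive number. *)
Definition third_root : R := 4 * r ^ 2 / (A1 * A2).

(* Along a solution, [B = level phi] where [phi' = speed B]: this removes the
   square-root singularities of the first integral at the turning points. *)
Definition level (psi : R) : R := (A1 + A2) / 2 - (A1 - A2) / 2 * cos psi.

Definition speed (b : R) : R := sqrt ((b + third_root) / (r ^ 2 * b)).

(** Inverse of [level] on the half turn from 0 to [PI], where [level] increases from [A2] to
    [A1]. *)
Definition phase (b : R) : R := acos (((A1 + A2) / 2 - b) / ((A1 - A2) / 2)).

Lemma third_root_pos : 0 < third_root.
Proof.
unfold third_root; apply Rdiv_lt_0_compat; [nra | ].
apply Rmult_lt_0_compat; lra.
Qed.

Lemma level_bounds (psi : R) : A2 <= level psi <= A1.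
Proof. unfold level; generalize (COS_bound psi); intros; nra. Qed.

Lemma speed_sq_pos (b : R) : 0 < b -> 0 < (b + third_root) / (r ^ 2 * b).
Proof.
intros hb; generalize third_root_pos; intros hD.
apply Rdiv_lt_0_compat; [lra | ].
apply Rmult_lt_0_compat; [apply pow_lt |]; lra.
Qed.

Lemma speed_pos (b : R) : 0 < b -> 0 < speed b.
Proof. intros hb; apply sqrt_lt_R0, speed_sq_pos, hb. Qed.

Lemma speed_sq (b : R) : 0 < b -> speed b ^ 2 = (b + third_root) / (r ^ 2 * b).
Proof. intros hb; apply pow2_sqrt, Rlt_le, speed_sq_pos, hb. Qed.

Lemma is_derive_speed (b : R) : 0 < b ->
  is_derive speed b (- third_root / (2 * r ^ 2 * b ^ 2 * speed b)).
Proof.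
intros hb; generalize (speed_sq_pos b hb) (speed_pos b hb); intros h1 h2.
unfold speed in *; auto_derive.
- repeat split; [ | simpl in *; lra].
  apply Rgt_not_eq; apply Rmult_lt_0_compat; [simpl; nra | lra].
- change (sqrt ((b + third_root) * / (r * (r * 1) * b)))
    with (sqrt ((b + third_root) / (r ^ 2 * b))).
  set (q := sqrt _) in *; clearbody q; field; lra.
Qed.

Lemma is_derive_level (psi : R) :
  is_derive level psi ((A1 - A2) / 2 * sin psi).
Proof. unfold level; auto_derive; [easy | field]. Qed.

Lemma continuous_over_level (g : R -> R) :
  (forall b, A2 <= b <= A1 -> ex_derive g b) ->
  forall psi, continuous (fun u => g (level u)) psi.
Proof.
intros hg psi; apply (ex_derive_continuous (fun u => g (level u))).
apply (ex_derive_comp g level).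
- apply hg, level_bounds.
- eexists; apply is_derive_level.
Qed.

Lemma ex_derive_div_speed (g : R -> R) (b : R) :
  0 < b -> ex_derive g b -> ex_derive (fun u => g u / speed u) b.
Proof.
intros hb hg; apply ex_derive_div; [easy | eexists; apply is_derive_speed, hb | ].
generalize (speed_pos b hb); lra.
Qed.

Lemma level_phase (b : R) : A2 <= b <= A1 -> level (phase b) = b.
Proof.
intros hb; unfold level, phase; rewrite cos_acos; [field; lra | ].
split; [apply Rle_div_r | apply Rle_div_l]; lra.
Qed.

Lemma phase_bounds (b : R) : 0 <= phase b <= PI.
Proof. apply acos_bound. Qed.

Lemma level_lt (p q : R) : 0 <= p -> q <= PI -> p < q -> level p < level q.
Proof.
intros hp hq hpq.
generalize (cos_decreasing_1 p q); unfold level; intros; nra.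
Qed.

Lemma level_0 : level 0 = A2.
Proof. unfold level; rewrite cos_0; lra. Qed.

Lemma level_PI : level PI = A1.
Proof. unfold level; rewrite cos_PI; lra. Qed.

(** The derivative of [phase] blows up at the turning points, so the limit comes from monotonicity
    of [level]: [b < level d] forces [phase b < d]. *)
Lemma phase_at_right : filterlim phase (at_right A2) (locally 0).
Proof.
intros P [e he]; unfold filtermap.
(* Capping at 1 keeps [d] inside the half turn on which [level] is increasing. *)
pose (d := Rmin e 1).
assert (hd : 0 < d <= 1 /\ d <= e).
{ unfold d; destruct e as [e hpos]; simpl; split; [split | ].
  - apply Rmin_glb_lt; lra.
  - apply Rmin_r.
  - apply Rmin_l. }
generalize PI2_1; intros hPI.
assert (hl : A2 < level d) by (rewrite <- level_0; apply level_lt; lra).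
assert (hl0 : 0 < level d - A2) by lra.
exists (mkposreal _ hl0); intros b hb hb2; apply he.
unfold ball in *; simpl in *; unfold AbsRing_ball, abs, minus, plus, opp in *; simpl in *.
rewrite Rabs_right in hb by lra.
generalize (level_bounds d) (phase_bounds b); intros h1 h2.
assert (h3 : level (phase b) = b) by (apply level_phase; lra).
rewrite Rabs_right by lra.
destruct (Rlt_dec (phase b) d) as [ | h]; [lra | exfalso].
destruct (Req_dec (phase b) d) as [h' | h'].
- rewrite h' in h3; lra.
- generalize (level_lt d (phase b)); lra.
Qed.

Lemma phase_at_left : filterlim phase (at_left A1) (locally PI).
Proof.
intros P [e he]; unfold filtermap.
pose (d := Rmin e 1).
assert (hd : 0 < d <= 1 /\ d <= e).
{ unfold d; destruct e as [e hpos]; simpl; split; [split | ].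
  - apply Rmin_glb_lt; lra.
  - apply Rmin_r.
  - apply Rmin_l. }
generalize PI2_1; intros hPI.
assert (hl : level (PI - d) < A1) by (rewrite <- level_PI; apply level_lt; lra).
assert (hl0 : 0 < A1 - level (PI - d)) by lra.
exists (mkposreal _ hl0); intros b hb hb2; apply he.
unfold ball in *; simpl in *; unfold AbsRing_ball, abs, minus, plus, opp in *; simpl in *.
rewrite Rabs_left in hb by lra.
generalize (level_bounds (PI - d)) (phase_bounds b); intros h1 h2.
assert (h3 : level (phase b) = b) by (apply level_phase; lra).
rewrite Rabs_left1 by lra.
destruct (Rlt_dec (PI - d) (phase b)) as [ | h]; [lra | exfalso].
destruct (Req_dec (phase b) (PI - d)) as [h' | h'].
- rewrite h' in h3; lra.
- generalize (level_lt (phase b) (PI - d)); lra.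
Qed.

Lemma is_derive_phase (b : R) : A2 < b < A1 ->
  is_derive phase b (/ sqrt ((A1 - b) * (b - A2))).
Proof.
intros hb; unfold phase.
assert (hy : -1 < ((A1 + A2) / 2 - b) / ((A1 - A2) / 2) < 1).
{ split; [apply Rlt_div_r | apply Rlt_div_l]; lra. }
set (y := ((A1 + A2) / 2 - b) / ((A1 - A2) / 2)) in *.
assert (hs : sqrt ((A1 - b) * (b - A2)) = (A1 - A2) / 2 * sqrt (1 - y²)).
{ rewrite <- (sqrt_Rsqr ((A1 - A2) / 2)) at 1 by lra.
  rewrite <- sqrt_mult_alt by apply Rle_0_sqr.
  f_equal; unfold y, Rsqr; field; lra. }
assert (hs0 : 0 < sqrt (1 - y²)) by (apply sqrt_lt_R0; unfold Rsqr; nra).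
replace (/ sqrt ((A1 - b) * (b - A2)))
  with (scal (- / ((A1 - A2) / 2)) (- 1 / sqrt (1 - y²))).
2: { rewrite hs; unfold scal; simpl; unfold mult; simpl; field; lra. }
apply (is_derive_comp acos (fun u => ((A1 + A2) / 2 - u) / ((A1 - A2) / 2))).
- apply is_derive_acos, hy.
- auto_derive; [ | field]; lra.
Qed.

(** Splits the root of the factored first integral into a factor that is smooth at the turning
    points and the reciprocal of the derivative of [phase]. *)
Lemma speed_phase_density (b : R) : A2 < b ->
  sqrt ((A1 - b) * (b - A2) * (b + third_root) / (r ^ 2 * b))
  = speed b * sqrt ((A1 - b) * (b - A2)).
Proof.
intros hb; unfold speed; rewrite <- sqrt_mult_alt.
- f_equal; field; lra.
- apply Rlt_le, speed_sq_pos; lra.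
Qed.

(** Allows every pointwise argument about the improper integral to be made strictly between the
    turning points. *)
Lemma filter_prod_between_roots :
  filter_prod (at_right A2) (at_left A1)
    (fun ab => forall x, Rmin (fst ab) (snd ab) <= x <= Rmax (fst ab) (snd ab) ->
       A2 < x < A1).
Proof.
assert (h0 : 0 < A1 - A2) by lra.
apply (Filter_prod _ _ _ (fun u => A2 < u < A1) (fun u => A2 < u < A1)).
- exists (mkposreal _ h0); intros y hy hy2.
  unfold ball in hy; simpl in hy; unfold AbsRing_ball, abs, minus, plus, opp in hy;
    simpl in hy; apply Rabs_def2 in hy; lra.
- exists (mkposreal _ h0); intros y hy hy2.
  unfold ball in hy; simpl in hy; unfold AbsRing_ball, abs, minus, plus, opp in hy;
    simpl in hy; apply Rabs_def2 in hy; lra.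
- simpl; intros u v hu hv x; unfold Rmin, Rmax; destruct (Rle_dec u v); lra.
Qed.

(** Substitution [b = level u]. The integrand of the right-hand side is continuous up to the ends,
    so its primitive [K] composed with [phase] is a primitive of the left-hand integrand between the
    roots, with one-sided limits [K 0] and [K PI]. *)
Lemma is_RInt_gen_between_roots (g : R -> R) :
  (forall b, A2 <= b <= A1 -> ex_derive g b) ->
  is_RInt_gen
    (fun b => g b / sqrt ((A1 - b) * (b - A2) * (b + third_root) / (r ^ 2 * b)))
    (at_right A2) (at_left A1)
    (RInt (fun u => g (level u) / speed (level u)) 0 PI).
Proof.
intros hg.
pose (k := fun u => g (level u) / speed (level u)).
pose (K := fun y => RInt k 0 y).
pose (f := fun b => g b / (speed b * sqrt ((A1 - b) * (b - A2)))).
assert (hk : forall u, continuous k u).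
{ intros u; apply (continuous_over_level (fun b => g b / speed b)).
  intros b hb; apply ex_derive_div_speed; [lra | apply hg, hb]. }
assert (hK : forall u, is_derive K u (k u)) by apply is_derive_RInt_from_0, hk.
assert (hH : forall b, A2 < b < A1 -> is_derive (fun u => K (phase u)) b (f b)).
{ intros b hb.
  replace (f b) with (scal (/ sqrt ((A1 - b) * (b - A2))) (k (phase b))).
  - apply (is_derive_comp K phase); [apply hK | apply is_derive_phase, hb].
  - assert (h1 : 0 < sqrt ((A1 - b) * (b - A2))).
    { apply sqrt_lt_R0, Rmult_lt_0_compat; lra. }
    generalize (speed_pos b); intros h2.
    unfold k, f, scal; simpl; unfold mult; simpl; rewrite level_phase by lra.
    field; lra. }
assert (hf : forall b, A2 < b < A1 -> continuous f b).
{ intros b hb; apply (ex_derive_continuous f).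
  assert (h1 : 0 < sqrt ((A1 - b) * (b - A2))).
  { apply sqrt_lt_R0, Rmult_lt_0_compat; lra. }
  apply (ex_derive_div g (fun b => speed b * sqrt ((A1 - b) * (b - A2)))).
  - apply hg; lra.
  - apply (ex_derive_mult speed (fun b => sqrt ((A1 - b) * (b - A2)))).
    + eexists; apply is_derive_speed; lra.
    + auto_derive; apply Rmult_lt_0_compat; lra.
  - apply Rgt_not_eq, Rmult_lt_0_compat; [apply speed_pos; lra | easy]. }
assert (hloc : forall b, A2 < b < A1 -> locally b (fun u => A2 < u < A1)).
{ intros b hb; apply (locally_interval _ b A2 A1); simpl; try lra.
  intros; split; assumption. }
pose proof filter_prod_between_roots as hbox.
assert (hint : is_RInt_gen (Derive (fun u => K (phase u))) (at_right A2) (at_left A1)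
                 (K PI - K 0)).
{ apply is_RInt_gen_Derive.
  - revert hbox; apply filter_imp; intros ab h x hx.
    eexists; apply hH, h, hx.
  - revert hbox; apply filter_imp; intros ab h x hx.
    apply (continuous_ext_loc _ f); [ | apply hf, h, hx].
    generalize (hloc x (h x hx)); apply filter_imp; intros y hy.
    symmetry; apply is_derive_unique, hH, hy.
  - apply (filterlim_comp _ _ _ phase K _ (locally 0)); [apply phase_at_right | ].
    apply (ex_derive_continuous K); eexists; apply hK.
  - apply (filterlim_comp _ _ _ phase K _ (locally PI)); [apply phase_at_left | ].
    apply (ex_derive_continuous K); eexists; apply hK. }
replace (RInt _ 0 PI) with (K PI - K 0).
2: { unfold K; rewrite (RInt_point 0 k); unfold zero; simpl; fold k; ring. }
revert hint; apply is_RInt_gen_ext.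
revert hbox; apply filter_imp; intros ab h x hx.
assert (hx' : A2 < x < A1) by (apply h; lra).
transitivity (f x); [exact (is_derive_unique _ _ _ (hH x hx')) | ].
unfold f; now rewrite speed_phase_density by lra.
Qed.

End Oscillation.

(** * Periodicity *)

Section Period.

Variables r A1 A2 : R.
Hypotheses (hr : 0 < r) (hA2 : 0 < A2) (hA : A2 < A1).

Local Notation D := (third_root r A1 A2).
Local Notation spd := (speed r A1 A2).
Local Notation lev := (level A1 A2).

(** The rescaled point [(X, Y)] lies on the unit circle by the first integral and turns with angular
    speed [sB] by the second-order equation, so [polar_lift] yields the phase. The first integral
    alone would allow [B] to rest at a turning point. *)
Lemma phase_lift (B B1 : R -> R) :
  (forall s, 0 < B s) ->
  (forall s, is_derive B s (B1 s)) ->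
  (forall s, is_derive B1 s
     ((A1 + A2 - D) / (2 * r ^ 2) + 2 / B s ^ 2 - B s / r ^ 2)) ->
  (forall s, B1 s ^ 2 = (A1 - B s) * (B s - A2) * (B s + D) / (r ^ 2 * B s)) ->
  exists phi, (forall s, is_derive phi s (spd (B s))) /\
    forall s, B s = lev (phi s).
Proof.
intros hpos hB hB1 hE.
pose (sB := fun s => spd (B s)).
assert (hsB : forall s, 0 < sB s) by (intros s; apply speed_pos; auto).
assert (hsB2 : forall s, sB s ^ 2 = (B s + D) / (r ^ 2 * B s)).
{ intros s; apply speed_sq; auto. }
assert (dsB : forall s, is_derive sB s (B1 s * (- D / (2 * r ^ 2 * B s ^ 2 * sB s)))).
{ intros s; apply (is_derive_comp spd B); [ | apply hB].
  apply is_derive_speed; auto. }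
pose (X := fun s => ((A1 + A2) / 2 - B s) / ((A1 - A2) / 2)).
pose (Y := fun s => B1 s / ((A1 - A2) / 2 * sB s)).
assert (hX : forall s, is_derive X s (- Y s * sB s)).
{ intros s; unfold X, Y; auto_derive; [solve_derive_side; try lra | ].
  rewrite_derive hB; generalize (hsB s); intros; field; lra. }
(* The force is half the derivative in [B] of [(A1 - B) * (B - A2) * sB ^ 2]; its last term cancels
   the contribution of the derivative of [sB] to that of [Y]. *)
assert (hid : forall s,
  (A1 + A2 - D) / (2 * r ^ 2) + 2 / B s ^ 2 - B s / r ^ 2
  = ((A1 + A2) / 2 - B s) * sB s ^ 2
    - (A1 - B s) * (B s - A2) * D / (2 * r ^ 2 * B s ^ 2)).
{ intros s; rewrite hsB2; generalize (hpos s); intros h.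
  unfold third_root; field; lra. }
assert (hE2 : forall s, B1 s ^ 2 = (A1 - B s) * (B s - A2) * sB s ^ 2).
{ intros s; rewrite hE, hsB2; generalize (hpos s); intros h; field; lra. }
assert (hY : forall s, is_derive Y s (X s * sB s)).
{ intros s; unfold X, Y; auto_derive.
  - solve_derive_side. apply Rgt_not_eq, Rmult_lt_0_compat; [lra | apply hsB].
  - rewrite_derive hB1; rewrite_derive dsB; rewrite hid.
    generalize (hsB s) (hE2 s) (hpos s); intros h1 h2 h3.
    field_simplify_eq; [ | lra].
    replace (B1 s ^ 2) with ((A1 - B s) * (B s - A2) * sB s ^ 2); ring. }
assert (hXY : forall s, X s ^ 2 + Y s ^ 2 = 1).
{ intros s; generalize (hE2 s) (hsB s); intros h1 h2.
  unfold X, Y; field_simplify_eq; [ | lra].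
  rewrite h1; ring. }
destruct (polar_lift X Y _ _ (fun y => RInt sB 0 y) hX hY) as [t0 ht].
- intros s; rewrite hXY; lra.
- intros s; rewrite hXY.
  replace (_ / 1) with (sB s).
  + apply is_derive_RInt_from_0; intros u; apply (ex_derive_continuous sB).
    eexists; apply dsB.
  + transitivity (sB s * (X s ^ 2 + Y s ^ 2)); [rewrite hXY; ring | field].
- exists (fun s => RInt sB 0 s + t0); split.
  + intros s; apply (is_derive_value _ _ (plus (sB s) zero)); [ | apply plus_zero_r].
    apply (is_derive_plus (fun y => RInt sB 0 y) (fun _ => t0)).
    * apply (is_derive_RInt_from_0 sB); intros u; apply (ex_derive_continuous sB).
      eexists; apply dsB.
    * apply (is_derive_const t0).
  + intros s; destruct (ht s) as [h _]; rewrite hXY, sqrt_1, Rmult_1_l in h.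
    unfold level; rewrite <- h; unfold X; field; lra.
Qed.

(** Time that the phase needs to advance from 0 to [psi], obtained by separating variables in
    [phi' = speed (level phi)]. *)
Definition travel_time (psi : R) : R := RInt (fun u => 1 / spd (lev u)) 0 psi.

Lemma continuous_over_speed (g : R -> R) :
  (forall b, A2 <= b <= A1 -> ex_derive g b) ->
  forall psi, continuous (fun u => g (lev u) / spd (lev u)) psi.
Proof.
intros hg psi.
apply (continuous_over_level A1 A2 hA (fun b => g b / spd b)).
intros b hb; apply ex_derive_div_speed; auto; lra.
Qed.

Lemma is_derive_travel_time (psi : R) :
  is_derive travel_time psi (1 / spd (lev psi)).
Proof.
apply (is_derive_RInt_from_0 (fun u => 1 / spd (lev u))).
apply (continuous_over_speed (fun _ => 1)); intros; apply ex_derive_const.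
Qed.

Lemma level_pos (psi : R) : 0 < lev psi.
Proof. generalize (level_bounds A1 A2 hA psi); lra. Qed.

Lemma spd_level_pos (psi : R) : 0 < spd (lev psi).
Proof. apply speed_pos; auto; apply level_pos. Qed.

Lemma travel_time_incr (p q : R) : p < q -> travel_time p < travel_time q.
Proof.
apply (positive_derivative_incr _ _ is_derive_travel_time).
intros s; generalize (spd_level_pos s); intros; apply Rdiv_lt_0_compat; lra.
Qed.

Lemma level_periodic (psi : R) : lev (psi + 2 * PI) = lev psi.
Proof.
unfold level; rewrite cos_plus, cos_2PI, sin_2PI; ring.
Qed.

Lemma level_symmetric (psi : R) : lev (PI + psi) = lev (PI - psi).
Proof.
unfold level; rewrite cos_plus, cos_minus, sin_PI; ring.
Qed.

Lemma travel_time_shift (psi : R) :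
  travel_time (psi + 2 * PI) = travel_time psi + travel_time (2 * PI).
Proof.
apply (RInt_periodic_shift (fun u => 1 / spd (lev u))).
- apply (continuous_over_speed (fun _ => 1)); intros; apply ex_derive_const.
- intros x; now rewrite level_periodic.
Qed.

(** * Period of a solution and integrals over one period *)

Section Along.

Variables B phi : R -> R.
Hypotheses (hphi : forall s, is_derive phi s (spd (B s)))
  (hB : forall s, B s = lev (phi s)).

Lemma travel_time_phi (s : R) : travel_time (phi s) = s + travel_time (phi 0).
Proof.
assert (h : forall s, is_derive (fun u => travel_time (phi u) - u) s 0).
{ intros u.
  apply (is_derive_value _ _ (minus (scal (spd (B u)) (1 / spd (lev (phi u)))) 1)).
  - apply (is_derive_minus (fun u => travel_time (phi u)) (fun u => u)).
    + apply (is_derive_comp travel_time phi); [apply is_derive_travel_time | apply hphi].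
    + apply (is_derive_id u).
  - rewrite <- hB; generalize (spd_level_pos (phi u)); rewrite <- hB; intros h.
    unfold minus, plus, opp, scal; simpl; unfold mult; simpl; field; lra. }
generalize (null_derivative_constant _ h s 0); simpl; lra.
Qed.

Lemma travel_time_inj (p q : R) : travel_time p = travel_time q -> p = q.
Proof.
intros h; destruct (Rtotal_order p q) as [h' | [h' | h']]; [ | easy | ];
  generalize (travel_time_incr _ _ h'); lra.
Qed.

(** Both sides have the same travel time: along [phi] it grows like [s], and a full turn adds a
    fixed amount. *)
Lemma phi_period (s : R) : phi (s + travel_time (2 * PI)) = phi s + 2 * PI.
Proof.
apply travel_time_inj.
rewrite travel_time_shift, (travel_time_phi s), (travel_time_phi (s + _)); ring.
Qed.

(** For minimality, start where the phase is 0, so that [B] is at its minimum [A2]. A period [q]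
    brings [B] back to [A2] at a positive phase of cosine 1, hence after at least one full turn. *)
Lemma least_period_travel_time : least_period B (travel_time (2 * PI)).
Proof.
generalize PI_RGT_0; intros hPI.
assert (h0 : travel_time 0 = 0).
{ unfold travel_time; now rewrite (RInt_point 0 (fun u => 1 / spd (lev u))). }
split; [ | split].
- rewrite <- h0; apply travel_time_incr; lra.
- intros s; now rewrite (hB (s + _)), phi_period, level_periodic, hB.
- intros q hq hper.
  (* By [travel_time_phi], this is the time at which the phase vanishes. *)
  set (s := - travel_time (phi 0)).
  assert (hs : phi s = 0).
  { apply travel_time_inj; rewrite (travel_time_phi s), h0; unfold s; ring. }
  assert (h1 : 0 < phi (s + q)).
  { rewrite <- hs; apply (positive_derivative_incr phi (fun s => spd (B s)) hphi); [ | lra].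
    intros u; rewrite hB; apply spd_level_pos. }
  assert (h2 : cos (phi (s + q)) = 1).
  { generalize (hper s); rewrite !hB, hs; unfold level; rewrite cos_0; nra. }
  generalize (cos_eq_1_ge_2PI _ h1 h2); intros h3.
  assert (h4 : travel_time (2 * PI) <= travel_time (phi (s + q))).
  { destruct h3 as [h3 | h3]; [apply Rlt_le, travel_time_incr, h3 | rewrite h3; lra]. }
  rewrite (travel_time_phi (s + q)) in h4; unfold s in h4; lra.
Qed.

(** Provides a primitive of [g (B s)] in arc length as an integral over the phase: the factor [phi']
    cancels the division by the speed. *)
Lemma is_derive_RInt_phi (g : R -> R) :
  (forall b, A2 <= b <= A1 -> ex_derive g b) ->
  forall s, is_derive (fun s => RInt (fun u => g (lev u) / spd (lev u)) 0 (phi s)) s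
              (g (B s)).
Proof.
intros hg s.
replace (g (B s)) with (scal (spd (B s)) (g (lev (phi s)) / spd (lev (phi s)))).
- apply (is_derive_comp (fun y => RInt (fun u => g (lev u) / spd (lev u)) 0 y) phi).
  + apply (is_derive_RInt_from_0 (fun u => g (lev u) / spd (lev u))).
    now apply continuous_over_speed.
  + apply hphi.
- rewrite <- hB; generalize (spd_level_pos (phi s)); rewrite <- hB; intros h.
  unfold scal; simpl; unfold mult; simpl; field; lra.
Qed.

(** One period is one turn of the phase, and its two halves contribute equally because [level] is
    symmetric about [PI]. *)
Lemma RInt_phi_over_period (g : R -> R) :
  (forall b, A2 <= b <= A1 -> ex_derive g b) ->
  forall s,
    RInt (fun u => g (lev u) / spd (lev u)) 0 (phi (s + travel_time (2 * PI)))
    - RInt (fun u => g (lev u) / spd (lev u)) 0 (phi s)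
    = 2 * RInt (fun u => g (lev u) / spd (lev u)) 0 PI.
Proof.
intros hg s.
pose proof (continuous_over_speed g hg) as hc.
rewrite phi_period.
rewrite (RInt_periodic_shift (fun u => g (lev u) / spd (lev u)) (2 * PI) hc).
- rewrite (RInt_even_periodic (fun u => g (lev u) / spd (lev u)) PI hc); [ring | ].
  intros x; now rewrite level_symmetric.
- intros x; now rewrite level_periodic.
Qed.

End Along.

End Period.

(** * Curves on the sphere *)

Lemma vec_ext (u v : vec) : c1 u = c1 v -> c2 u = c2 v -> c3 u = c3 v -> u = v.
Proof.
destruct u as [[a b] c], v as [[a' b'] c']; unfold c1, c2, c3; simpl.
now intros -> -> ->.
Qed.

Lemma c1_plus (u v : vec) : c1 (plus u v) = c1 u + c1 v.
Proof. reflexivity. Qed.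

Lemma c2_plus (u v : vec) : c2 (plus u v) = c2 u + c2 v.
Proof. reflexivity. Qed.

Lemma c3_plus (u v : vec) : c3 (plus u v) = c3 u + c3 v.
Proof. reflexivity. Qed.

Lemma c1_minus (u v : vec) : c1 (minus u v) = c1 u - c1 v.
Proof. reflexivity. Qed.

Lemma c2_minus (u v : vec) : c2 (minus u v) = c2 u - c2 v.
Proof. reflexivity. Qed.

Lemma c3_minus (u v : vec) : c3 (minus u v) = c3 u - c3 v.
Proof. reflexivity. Qed.

Lemma c1_scal (k : R) (u : vec) : c1 (scal k u) = k * c1 u.
Proof. reflexivity. Qed.

Lemma c2_scal (k : R) (u : vec) : c2 (scal k u) = k * c2 u.
Proof. reflexivity. Qed.

Lemma c3_scal (k : R) (u : vec) : c3 (scal k u) = k * c3 u.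
Proof. reflexivity. Qed.

Lemma c1_cross (u v : vec) : c1 (cross u v) = c2 u * c3 v - c3 u * c2 v.
Proof. reflexivity. Qed.

Lemma c2_cross (u v : vec) : c2 (cross u v) = c3 u * c1 v - c1 u * c3 v.
Proof. reflexivity. Qed.

Lemma c3_cross (u v : vec) : c3 (cross u v) = c1 u * c2 v - c2 u * c1 v.
Proof. reflexivity. Qed.

#[local] Hint Rewrite c1_plus c2_plus c3_plus c1_minus c2_minus c3_minus
  c1_scal c2_scal c3_scal c1_cross c2_cross c3_cross : coords.

(** Dot products stay folded here, so that they can serve as atoms with known values; [coords]
    expands them as well. *)
Ltac vcoords :=
  autorewrite with coords;
  repeat match goal with
  | |- context [c1 (@zero ?G)] => change (c1 (@zero G)) with 0
  | |- context [c2 (@zero ?G)] => change (c2 (@zero G)) with 0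
  | |- context [c3 (@zero ?G)] => change (c3 (@zero G)) with 0
  end.

Ltac coords := unfold dot; vcoords.

(** * Differentiation of vector functions and identities for dot and cross products *)

Definition is_vderive (u : R -> vec) (s : R) (v : vec) : Prop :=
  is_derive (fun t => c1 (u t)) s (c1 v) /\
  is_derive (fun t => c2 (u t)) s (c2 v) /\
  is_derive (fun t => c3 (u t)) s (c3 v).

Lemma is_derive_Rmult (f g : R -> R) (s a b : R) :
  is_derive f s a -> is_derive g s b ->
  is_derive (fun t => f t * g t) s (a * g s + f s * b).
Proof. intros hf hg; apply (is_derive_mult f g); auto; intros; apply Rmult_comm. Qed.

Lemma is_derive_dot (u v : R -> vec) (s : R) (u' v' : vec) :
  is_vderive u s u' -> is_vderive v s v' ->
  is_derive (fun t => dot (u t) (v t)) s (dot u' (v s) + dot (u s) v').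
Proof.
intros [h1 [h2 h3]] [k1 [k2 k3]]; unfold dot.
eapply is_derive_value.
- apply (is_derive_plus (fun t => c1 (u t) * c1 (v t) + c2 (u t) * c2 (v t))
           (fun t => c3 (u t) * c3 (v t))).
  + apply (is_derive_plus (fun t => c1 (u t) * c1 (v t)) (fun t => c2 (u t) * c2 (v t)));
      apply is_derive_Rmult; eassumption.
  + apply is_derive_Rmult; eassumption.
- unfold plus; simpl; ring.
Qed.

Lemma is_derive_Rmult_sub (f g h k : R -> R) (s a b c d : R) :
  is_derive f s a -> is_derive g s b -> is_derive h s c -> is_derive k s d ->
  is_derive (fun t => f t * g t - h t * k t) s
    ((a * g s - c * k s) + (f s * b - h s * d)).
Proof.
intros hf hg hh hk; eapply is_derive_value.
- apply (is_derive_minus (fun t => f t * g t) (fun t => h t * k t));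
    apply is_derive_Rmult; eassumption.
- unfold minus, plus, opp; simpl; ring.
Qed.

Lemma is_vderive_cross (u v : R -> vec) (s : R) (u' v' : vec) :
  is_vderive u s u' -> is_vderive v s v' ->
  is_vderive (fun t => cross (u t) (v t)) s (plus (cross u' (v s)) (cross (u s) v')).
Proof.
intros [h1 [h2 h3]] [k1 [k2 k3]]; unfold is_vderive.
rewrite c1_plus, c2_plus, c3_plus, !c1_cross, !c2_cross, !c3_cross.
split; [ | split].
- exact (is_derive_Rmult_sub _ _ _ _ _ _ _ _ _ h2 k3 h3 k2).
- exact (is_derive_Rmult_sub _ _ _ _ _ _ _ _ _ h3 k1 h1 k3).
- exact (is_derive_Rmult_sub _ _ _ _ _ _ _ _ _ h1 k2 h2 k1).
Qed.

Lemma is_vderive_const (v : vec) (s : R) : is_vderive (fun _ => v) s zero.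
Proof.
split; [ | split];
  [apply (is_derive_const (c1 v)) | apply (is_derive_const (c2 v))
  | apply (is_derive_const (c3 v))].
Qed.

(** Expansion of [v] in the frame [x], [t], [cross x t], with the Gram determinant of [x] and [t]
    kept as a factor to avoid division. *)
Lemma gram_expansion (x t v : vec) :
  scal (dot x x * dot t t - dot x t ^ 2) v
  = plus (scal (dot v x * dot t t - dot v t * dot x t) x)
      (plus (scal (dot v t * dot x x - dot v x * dot x t) t)
         (scal (dot v (cross x t)) (cross x t))).
Proof. apply vec_ext; coords; ring. Qed.

Lemma cross_cross_l (x t : vec) :
  cross x (cross x t) = minus (scal (dot x t) x) (scal (dot x x) t).
Proof. apply vec_ext; coords; ring. Qed.

(** A vector parallel to two orthogonal nonzero vectors: its three coefficients in [gram_expansion]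
    vanish, by the triple product and by Lagrange's identity for the dot product of two cross
    products. *)
Lemma cross_eq_zero_pair (d x t : vec) :
  dot x t = 0 -> 0 < dot x x -> 0 < dot t t ->
  cross d x = zero -> cross d t = zero -> d = zero.
Proof.
intros hxt hx ht h1 h2.
assert (hz : forall v, dot zero v = 0) by (intros v; coords; ring).
assert (e1 : dot d (cross x t) = 0).
{ transitivity (dot (cross d x) t); [coords; ring | now rewrite h1]. }
assert (e2 : dot d x * dot t t = 0).
{ transitivity (dot (cross d t) (cross x t) + dot d t * dot x t); [coords; ring | ].
  rewrite h2, hz, hxt; ring. }
assert (e3 : dot d t * dot x x = 0).
{ transitivity (dot (cross d x) (cross t x) + dot d x * dot x t); [coords; ring | ].
  rewrite h1, hz, hxt; ring. }
assert (h : scal (dot x x * dot t t) d = zero).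
{ transitivity (scal (dot x x * dot t t - dot x t ^ 2) d).
  - rewrite hxt; f_equal; ring.
  - rewrite gram_expansion, e1, e2, e3, hxt; apply vec_ext; vcoords; ring. }
assert (hp : 0 < dot x x * dot t t) by now apply Rmult_lt_0_compat.
transitivity (scal (/ (dot x x * dot t t)) (scal (dot x x * dot t t) d)).
- apply vec_ext; vcoords; field; lra.
- rewrite h; apply vec_ext; vcoords; ring.
Qed.

Lemma dot_comm (u v : vec) : dot u v = dot v u.
Proof. coords; ring. Qed.

Lemma dot_derive_of_constant (u v : R -> vec) (u' v' : vec) (c s : R) :
  is_vderive u s u' -> is_vderive v s v' -> (forall t, dot (u t) (v t) = c) ->
  dot u' (v s) + dot (u s) v' = 0.
Proof.
intros hu hv hc.
transitivity (Derive (fun t => dot (u t) (v t)) s).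
- symmetry; apply is_derive_unique, is_derive_dot; assumption.
- rewrite (Derive_ext _ (fun _ => c)); [apply Derive_const | exact hc].
Qed.

(** The coefficient is the signed length of [w]; its sign records the orientation of the basis. *)
Lemma orthogonal_to_basis_parallel (w e1 e2 : vec) :
  orthonormal_basis_of_orthogonal w e1 e2 ->
  w = scal (dot w (cross e1 e2)) (cross e1 e2).
Proof.
intros [h1 [h2 [h3 [h4 h5]]]].
transitivity (scal (dot e1 e1 * dot e2 e2 - dot e1 e2 ^ 2) w).
- rewrite h1, h2, h3; apply vec_ext; vcoords; ring.
- rewrite gram_expansion, (dot_comm w e1), (dot_comm w e2), h4, h5.
  apply vec_ext; vcoords; ring.
Qed.

Lemma cross_in_orthogonal_plane (w e1 e2 v : vec) :
  orthonormal_basis_of_orthogonal w e1 e2 ->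
  cross w v = scal (dot w (cross e1 e2))
                (minus (scal (dot v e1) e2) (scal (dot v e2) e1)).
Proof.
intros h.
rewrite (orthogonal_to_basis_parallel w e1 e2 h) at 1.
set (l := dot w _); clearbody l.
apply vec_ext; coords; ring.
Qed.

Lemma dot_in_orthogonal_plane (w e1 e2 : vec) :
  orthonormal_basis_of_orthogonal w e1 e2 ->
  dot w w = dot w (cross e1 e2) ^ 2.
Proof.
intros h; pose proof (orthogonal_to_basis_parallel w e1 e2 h) as hw.
transitivity (dot w (scal (dot w (cross e1 e2)) (cross e1 e2))).
- now rewrite <- hw.
- set (n := cross e1 e2); clearbody n.
  set (l := dot w n).
  transitivity (l * dot w n); [coords; ring | unfold l; ring].
Qed.

(** Normalize [v] and [cross w v]. *)
Lemma orthonormal_basis_exists (w v : vec) :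
  0 < dot w w -> 0 < dot v v -> dot w v = 0 ->
  exists e1 e2, orthonormal_basis_of_orthogonal w e1 e2.
Proof.
intros hw hv hwv.
pose (a := / sqrt (dot v v)); pose (b := / sqrt (dot w w)).
assert (ha : a ^ 2 * dot v v = 1).
{ unfold a; rewrite <- (pow2_sqrt (dot v v)) at 2 by lra.
  field; apply Rgt_not_eq, sqrt_lt_R0, hv. }
assert (hb : b ^ 2 * dot w w = 1).
{ unfold b; rewrite <- (pow2_sqrt (dot w w)) at 2 by lra.
  field; apply Rgt_not_eq, sqrt_lt_R0, hw. }
clearbody a b.
exists (scal a v), (scal (a * b) (cross w v)).
split; [ | split; [ | split; [ | split]]].
- rewrite <- ha; coords; ring.
- transitivity ((a ^ 2 * dot v v) * (b ^ 2 * dot w w) - a ^ 2 * b ^ 2 * dot w v ^ 2).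
  + coords; ring.
  + rewrite ha, hb, hwv; ring.
- coords; ring.
- transitivity (a * dot w v); [coords; ring | rewrite hwv; ring].
- coords; ring.
Qed.

(** * Frame equations of a unit-speed curve on the sphere *)

Section SphericalCurve.

Variables (r : R) (x : R -> vec).
Hypotheses (hr : 0 < r) (hx : positively_curved_spherical_curve r x).

Local Notation T := (tangent x).
Local Notation N := (vDerive (tangent x)).
Local Notation M := (vDerive (vDerive (tangent x))).
Local Notation eps := (normal r x).
Local Notation kap := (kappa_g r x).

Lemma is_vderive_position (s : R) : is_vderive x s (T s).
Proof.
destruct hx as [h _]; destruct (h 1%nat s) as [h1 [h2 h3]]; [lia | ].
split; [exact (Derive_correct _ _ h1) | split;
  [exact (Derive_correct _ _ h2) | exact (Derive_correct _ _ h3)]].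
Qed.

Lemma is_vderive_tangent (s : R) : is_vderive T s (N s).
Proof.
destruct hx as [h _]; destruct (h 2%nat s) as [h1 [h2 h3]]; [lia | ].
split; [exact (Derive_correct _ _ h1) | split;
  [exact (Derive_correct _ _ h2) | exact (Derive_correct _ _ h3)]].
Qed.

Lemma is_vderive_acceleration (s : R) : is_vderive N s (M s).
Proof.
destruct hx as [h _]; destruct (h 3%nat s) as [h1 [h2 h3]]; [lia | ].
split; [exact (Derive_correct _ _ h1) | split;
  [exact (Derive_correct _ _ h2) | exact (Derive_correct _ _ h3)]].
Qed.

Lemma is_vderive_jerk (s : R) : is_vderive M s (vDerive M s).
Proof.
destruct hx as [h _]; destruct (h 4%nat s) as [h1 [h2 h3]]; [lia | ].
split; [exact (Derive_correct _ _ h1) | split;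
  [exact (Derive_correct _ _ h2) | exact (Derive_correct _ _ h3)]].
Qed.

Lemma dot_xx (s : R) : dot (x s) (x s) = r ^ 2.
Proof. apply hx. Qed.

Lemma dot_TT (s : R) : dot (T s) (T s) = 1.
Proof. apply hx. Qed.

Lemma dot_xT (s : R) : dot (x s) (T s) = 0.
Proof.
generalize (dot_derive_of_constant x x _ _ _ s (is_vderive_position s)
  (is_vderive_position s) dot_xx).
rewrite (dot_comm (T s)); lra.
Qed.

Lemma dot_NT (s : R) : dot (N s) (T s) = 0.
Proof.
generalize (dot_derive_of_constant T T _ _ _ s (is_vderive_tangent s)
  (is_vderive_tangent s) dot_TT).
rewrite (dot_comm (T s)); lra.
Qed.

Lemma dot_Nx (s : R) : dot (N s) (x s) = -1.
Proof.
generalize (dot_derive_of_constant x T _ _ _ s (is_vderive_position s)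
  (is_vderive_tangent s) dot_xT).
rewrite dot_TT, (dot_comm (x s)); lra.
Qed.

Lemma kappa_det (s : R) : kap s = dot (N s) (cross (x s) (T s)) / r.
Proof.
unfold kappa_g, nabla, normal.
set (k := dot (N s) (x s) / r ^ 2); clearbody k.
coords; field; lra.
Qed.

(** In the frame of position, tangent and normal, unit speed removes the tangential component, and
    differentiating [dot x T = 0] gives the radial one. *)
Lemma acceleration_frame (s : R) :
  N s = plus (scal (- / r ^ 2) (x s)) (scal (kap s) (eps s)).
Proof.
generalize (gram_expansion (x s) (T s) (N s)).
rewrite kappa_det, dot_xx, dot_TT, dot_xT, dot_NT, dot_Nx; unfold normal.
set (k := dot (N s) (cross (x s) (T s))); clearbody k.
set (n := cross (x s) (T s)); clearbody n.
intros h.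
transitivity (scal (/ r ^ 2) (scal (r ^ 2 * 1 - 0 ^ 2) (N s))).
- apply vec_ext; coords; field; lra.
- rewrite h; apply vec_ext; coords; field; lra.
Qed.

(** In the derivative of [cross x T] only the normal part of the acceleration survives, and
    [cross x (cross x T)] is [- r ^ 2] times [T]. *)
Lemma is_vderive_normal (s : R) : is_vderive eps s (scal (- kap s) (T s)).
Proof.
assert (h : is_vderive (fun t => cross (x t) (T t)) s (scal (- r * kap s) (T s))).
{ pose proof (is_vderive_cross x T s _ _ (is_vderive_position s) (is_vderive_tangent s)) as h.
  replace (scal (- r * kap s) (T s)) with (plus (cross (T s) (T s)) (cross (x s) (N s)));
    [exact h | ].
  rewrite acceleration_frame; unfold normal.
  transitivity (scal (kap s / r) (cross (x s) (cross (x s) (T s)))).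
  - apply vec_ext; coords; field; lra.
  - rewrite cross_cross_l, dot_xT, dot_xx; apply vec_ext; coords; field; lra. }
destruct h as [h1 [h2 h3]].
split; [ | split].
- apply (is_derive_value _ _ (scal (/ r) (c1 (scal (- r * kap s) (T s))))).
  + exact (is_derive_scal _ _ _ _ h1).
  + coords; unfold scal; simpl; unfold mult; simpl; field; lra.
- apply (is_derive_value _ _ (scal (/ r) (c2 (scal (- r * kap s) (T s))))).
  + exact (is_derive_scal _ _ _ _ h2).
  + coords; unfold scal; simpl; unfold mult; simpl; field; lra.
- apply (is_derive_value _ _ (scal (/ r) (c3 (scal (- r * kap s) (T s))))).
  + exact (is_derive_scal _ _ _ _ h3).
  + coords; unfold scal; simpl; unfold mult; simpl; field; lra.
Qed.

Lemma dot_epsT (s : R) : dot (eps s) (T s) = 0.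
Proof. unfold normal; coords; ring. Qed.

Lemma dot_epseps (s : R) : dot (eps s) (eps s) = 1.
Proof.
unfold normal.
transitivity ((dot (x s) (x s) * dot (T s) (T s) - dot (x s) (T s) ^ 2) / r ^ 2).
- coords; field; lra.
- rewrite dot_xx, dot_TT, dot_xT; field; lra.
Qed.

Lemma dot_epsx (s : R) : dot (eps s) (x s) = 0.
Proof. unfold normal; coords; ring. Qed.

Lemma dot_frame_combination (p q m : R) (s : R) :
  let w := plus (scal p (eps s)) (plus (scal q (T s)) (scal m (x s))) in
  dot w w = p ^ 2 + q ^ 2 + m ^ 2 * r ^ 2.
Proof.
cbv zeta.
transitivity (p ^ 2 * dot (eps s) (eps s) + q ^ 2 * dot (T s) (T s)
  + m ^ 2 * dot (x s) (x s) + 2 * p * q * dot (eps s) (T s)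
  + 2 * p * m * dot (eps s) (x s) + 2 * q * m * dot (x s) (T s)).
- coords; ring.
- rewrite dot_epseps, dot_TT, dot_xx, dot_epsT, dot_epsx, dot_xT; ring.
Qed.

(** Up to the factor [/ r], the curvature is the determinant of acceleration, position and tangent.
    Differentiating either of the last two gives a determinant with a repeated vector. *)
Lemma is_derive_kappa (s : R) :
  is_derive kap s (dot (M s) (cross (x s) (T s)) / r).
Proof.
apply (is_derive_ext (fun t => / r * dot (N t) (cross (x t) (T t)))).
{ intros t; rewrite kappa_det; apply Rmult_comm. }
pose proof (is_derive_dot N (fun t => cross (x t) (T t)) s _ _
  (is_vderive_acceleration s)
  (is_vderive_cross x T s _ _ (is_vderive_position s) (is_vderive_tangent s))) as h.
eapply is_derive_value; [exact (is_derive_scal _ _ (/ r) _ h) | ].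
coords; field; lra.
Qed.

Lemma ex_derive_dkappa (s : R) :
  ex_derive (fun t => dot (M t) (cross (x t) (T t)) / r) s.
Proof.
apply (ex_derive_ext (fun t => / r * dot (M t) (cross (x t) (T t)))).
{ intros t; apply Rmult_comm. }
pose proof (is_derive_dot M (fun t => cross (x t) (T t)) s _ _
  (is_vderive_jerk s)
  (is_vderive_cross x T s _ _ (is_vderive_position s) (is_vderive_tangent s))) as h.
exact (ex_intro _ _ (is_derive_scal _ _ (/ r) _ h)).
Qed.

End SphericalCurve.

(** * The Killing field of an extremal curve *)

(** One coordinate of the candidate rotation vector, where [X], [T], [E] are the same coordinate of
    position, tangent and normal, and [a] is half of the constant in the extremal equation. Writing
    [B] as [/ bet ^ 2] leaves integer exponents only. *)
Lemma killing_coordinate_constant (r a : R) (bet kap B1 X T E : R -> R) :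
  0 < r -> (forall s, 0 < bet s) ->
  (forall s, kap s = bet s ^ 3) ->
  (forall s, is_derive bet s (- (1 / 2) * bet s ^ 3 * B1 s)) ->
  (forall s, is_derive B1 s (a + 2 * bet s ^ 4 - / (r ^ 2 * bet s ^ 2))) ->
  (forall s, is_derive X s (T s)) ->
  (forall s, is_derive T s (- / r ^ 2 * X s + kap s * E s)) ->
  (forall s, is_derive E s (- kap s * T s)) ->
  forall s s', - (2 / r * bet s) * E s
                 + (- (B1 s / r) * T s + (a - / (r ^ 2 * bet s ^ 2)) / r * X s)
             = - (2 / r * bet s') * E s'
                 + (- (B1 s' / r) * T s' + (a - / (r ^ 2 * bet s' ^ 2)) / r * X s').
Proof.
intros hr hpos hk hbet hB1 hX hT hE.
apply (null_derivative_constant (fun s => - (2 / r * bet s) * E s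
                 + (- (B1 s / r) * T s + (a - / (r ^ 2 * bet s ^ 2)) / r * X s))).
intros s; generalize (hpos s); intros h.
auto_derive.
- solve_derive_side.
  apply Rgt_not_eq; repeat apply Rmult_lt_0_compat; lra.
- rewrite_derive hbet; rewrite_derive hB1; rewrite_derive hX; rewrite_derive hT;
    rewrite_derive hE.
  rewrite hk; field; lra.
Qed.

Section ExtremalCurve.

Variables (r a : R) (x : R -> vec).
Hypotheses (hr : 0 < r) (hx : extremal_curve r a x).

Local Notation T := (tangent x).
Local Notation eps := (normal r x).
Local Notation kap := (kappa_g r x).
Local Notation B := (Bfun r x).

Let hxs : positively_curved_spherical_curve r x := proj1 hx.

(** This is the cube root of the curvature; both the curvature and [B] are integer powers of it. *)
Definition cbrt_kappa (s : R) : R := Rpower (B s) (- 1 / 2).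

Local Notation bet := cbrt_kappa.

Lemma kappa_pos (s : R) : 0 < kap s.
Proof. apply hxs. Qed.

Lemma Bfun_pos (s : R) : 0 < B s.
Proof. apply exp_pos. Qed.

Lemma cbrt_kappa_pos (s : R) : 0 < bet s.
Proof. apply exp_pos. Qed.

Lemma cbrt_kappa_eq (s : R) : bet s = Rpower (kap s) (1 / 3).
Proof. unfold cbrt_kappa, Bfun; rewrite Rpower_mult; f_equal; field. Qed.

Lemma kappa_cube (s : R) : kap s = bet s ^ 3.
Proof.
rewrite <- Rpower_pow by apply cbrt_kappa_pos.
rewrite cbrt_kappa_eq, Rpower_mult; simpl INR.
replace (1 / 3 * (1 + 1 + 1)) with 1 by field.
now rewrite Rpower_1 by apply kappa_pos.
Qed.

Lemma Bfun_eq (s : R) : B s = / bet s ^ 2.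
Proof.
rewrite <- Rpower_pow by apply cbrt_kappa_pos.
rewrite cbrt_kappa_eq, Rpower_mult, <- Rpower_Ropp; unfold Bfun.
f_equal; simpl INR; field.
Qed.

Local Notation dkap := (fun t => dot (vDerive (vDerive T) t) (cross (x t) (T t)) / r).

Lemma is_derive_cbrt_kappa_aux (s : R) : is_derive bet s (dkap s / (3 * bet s ^ 2)).
Proof.
apply (is_derive_ext (fun t => exp (1 / 3 * ln (kap t)))).
{ intros t; now rewrite cbrt_kappa_eq. }
pose proof (is_derive_kappa r x hr hxs) as hk.
auto_derive.
- solve_derive_side; apply kappa_pos.
- rewrite_derive hk.
  fold (Rpower (kap s) (1 / 3)); change (exp (1 * / 3 * ln (kap s)))
    with (Rpower (kap s) (1 / 3)).
  rewrite <- cbrt_kappa_eq, kappa_cube; generalize (cbrt_kappa_pos s); intros h.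
  field; lra.
Qed.

Lemma is_derive_Bfun_aux (s : R) : is_derive B s (- (2 / 3) * dkap s / bet s ^ 5).
Proof.
apply (is_derive_ext (fun t => / bet t ^ 2)).
{ intros t; now rewrite Bfun_eq. }
pose proof is_derive_cbrt_kappa_aux as hb.
generalize (cbrt_kappa_pos s); intros h.
auto_derive.
- solve_derive_side; apply Rgt_not_eq; nra.
- rewrite_derive hb; field; lra.
Qed.

Lemma is_derive_Bfun (s : R) : is_derive B s (Derive B s).
Proof. apply Derive_correct; eexists; apply is_derive_Bfun_aux. Qed.

(** The extremal equation gives the value of the second derivative; its existence is shown
    separately, by differentiating the explicit formula for the first, which involves the fourth
    derivative of the curve. *)
Lemma is_derive_dBfun (s : R) :
  is_derive (Derive B) s (a / 2 + 2 * / B s ^ 2 - B s / r ^ 2).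
Proof.
apply (is_derive_value _ _ (Derive_n B 2 s)).
- apply Derive_correct.
  apply (ex_derive_ext (fun t => - (2 / 3) * dkap t / bet t ^ 5)).
  { intros t; symmetry; apply is_derive_unique, is_derive_Bfun_aux. }
  apply ex_derive_div.
  + apply ex_derive_scal, ex_derive_dkappa; assumption.
  + apply ex_derive_pow; eexists; apply is_derive_cbrt_kappa_aux.
  + apply pow_nonzero, Rgt_not_eq, cbrt_kappa_pos.
- generalize (proj2 hx s); unfold Rdiv; lra.
Qed.

Lemma is_derive_cbrt_kappa (s : R) :
  is_derive bet s (- (1 / 2) * bet s ^ 3 * Derive B s).
Proof.
apply (is_derive_value _ _ _ _ (is_derive_cbrt_kappa_aux s)).
rewrite (is_derive_unique _ _ _ (is_derive_Bfun_aux s)).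
generalize (cbrt_kappa_pos s); intros h; field; lra.
Qed.

(** The first two coefficients are forced by [J = cross w x]. The coefficient of the position does
    not affect this product; it is chosen to make the vector constant. *)
Definition killing_vector (s : R) : vec :=
  plus (scal (- (2 / r * bet s)) (eps s))
    (plus (scal (- (Derive B s / r)) (T s)) (scal ((a / 2 - B s / r ^ 2) / r) (x s))).

Lemma killing_vector_constant (s s' : R) : killing_vector s = killing_vector s'.
Proof.
assert (h : forall t, killing_vector t
  = plus (scal (- (2 / r * bet t)) (eps t))
      (plus (scal (- (Derive B t / r)) (T t))
         (scal ((a / 2 - / (r ^ 2 * bet t ^ 2)) / r) (x t)))).
{ intros t; unfold killing_vector; do 3 f_equal.
  rewrite Bfun_eq; generalize (cbrt_kappa_pos t); intros; field; lra. }
rewrite !h.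
assert (hB1 : forall t, is_derive (Derive B) t
  (a / 2 + 2 * bet t ^ 4 - / (r ^ 2 * bet t ^ 2))).
{ intros t; apply (is_derive_value _ _ _ _ (is_derive_dBfun t)).
  rewrite Bfun_eq; generalize (cbrt_kappa_pos t); intros; field; lra. }
assert (hT : forall t, is_vderive T t (plus (scal (- / r ^ 2) (x t)) (scal (kap t) (eps t)))).
{ intros t; rewrite <- (acceleration_frame r x hr hxs).
  exact (is_vderive_tangent r x hxs t). }
assert (hE := is_vderive_normal r x hr hxs).
assert (hX := is_vderive_position r x hxs).
apply vec_ext; vcoords.
- exact (killing_coordinate_constant r (a / 2) bet kap (Derive B)
    _ _ _ hr cbrt_kappa_pos kappa_cube is_derive_cbrt_kappa hB1
    (fun t => proj1 (hX t)) (fun t => proj1 (hT t)) (fun t => proj1 (hE t)) s s').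
- exact (killing_coordinate_constant r (a / 2) bet kap (Derive B)
    _ _ _ hr cbrt_kappa_pos kappa_cube is_derive_cbrt_kappa hB1
    (fun t => proj1 (proj2 (hX t))) (fun t => proj1 (proj2 (hT t)))
    (fun t => proj1 (proj2 (hE t))) s s').
- exact (killing_coordinate_constant r (a / 2) bet kap (Derive B)
    _ _ _ hr cbrt_kappa_pos kappa_cube is_derive_cbrt_kappa hB1
    (fun t => proj2 (proj2 (hX t))) (fun t => proj2 (proj2 (hT t)))
    (fun t => proj2 (proj2 (hE t))) s s').
Qed.

Lemma Jfield_killing_vector (s : R) : Jfield r x s = cross (killing_vector s) (x s).
Proof.
pose proof (dot_xx r x hxs s) as h1; pose proof (dot_xT r x hxs s) as h2.
unfold Jfield, killing_vector; fold (bet s).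
set (q := (a / 2 - B s / r ^ 2) / r); clearbody q.
assert (h : cross (eps s) (x s) = scal r (T s)).
{ transitivity (scal (- / r) (cross (x s) (cross (x s) (T s)))).
  - unfold normal; apply vec_ext; coords; ring.
  - rewrite cross_cross_l, h1, h2; apply vec_ext; coords; field; lra. }
assert (h' : cross (T s) (x s) = scal (- r) (eps s)).
{ unfold normal; apply vec_ext; coords; field; lra. }
transitivity (plus (scal (- (2 / r * bet s)) (cross (eps s) (x s)))
   (scal (- (Derive B s / r)) (cross (T s) (x s)))).
- rewrite h, h'; apply vec_ext; coords; field; lra.
- apply vec_ext; coords; ring.
Qed.

(** The difference [d] of two rotation vectors satisfies [cross d x = 0] along the curve.
    Differentiation gives [cross d T = 0] as well, hence [d = 0]. *)
Lemma killing_vector_unique (w : vec) (s : R) :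
  rotation_vector r x w -> w = killing_vector s.
Proof.
intros [_ hw].
pose (d := minus w (killing_vector s)).
assert (h1 : forall t, cross d (x t) = zero).
{ intros t; transitivity (minus (cross w (x t)) (cross (killing_vector s) (x t))).
  - unfold d; apply vec_ext; coords; ring.
  - rewrite (killing_vector_constant s t), <- Jfield_killing_vector, <- hw.
    apply vec_ext; coords; ring. }
assert (h2 : cross d (T s) = zero).
{ pose proof (is_vderive_cross (fun _ => d) x s _ _ (is_vderive_const d s)
    (is_vderive_position r x hxs s)) as [k1 [k2 k3]].
  assert (z : forall (f : R -> R) l, (forall t, f t = 0) -> is_derive f s l -> l = 0).
  { intros f l hf hl; transitivity (Derive f s).
    - symmetry; now apply is_derive_unique.
    - rewrite (Derive_ext _ (fun _ => 0)); [apply Derive_const | exact hf]. }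
  apply z in k1; [ | intros t; now rewrite h1].
  apply z in k2; [ | intros t; now rewrite h1].
  apply z in k3; [ | intros t; now rewrite h1].
  revert k1 k2 k3; vcoords; intros k1 k2 k3.
  apply vec_ext; vcoords; lra. }
assert (h3 : d = zero).
{ apply (cross_eq_zero_pair d (x s) (T s)); auto.
  - exact (dot_xT r x hxs s).
  - rewrite (dot_xx r x hxs); apply pow_lt, hr.
  - rewrite (dot_TT r x hxs); lra. }
transitivity (plus d (killing_vector s)).
- unfold d; apply vec_ext; vcoords; ring.
- rewrite h3; apply vec_ext; vcoords; ring.
Qed.

End ExtremalCurve.

(** * The progression angle *)

Section Progression.

Variables r C1 C2 A1 A2 : R.
Hypotheses (hr : 0 < r) (hA2 : 0 < A2) (hA : A2 < A1)
  (hroot1 : A1 ^ 3 / r ^ 2 - C1 * A1 ^ 2 - C2 * A1 + 4 = 0)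
  (hroot2 : A2 ^ 3 / r ^ 2 - C1 * A2 ^ 2 - C2 * A2 + 4 = 0).

Local Notation D := (third_root r A1 A2).
Local Notation spd := (speed r A1 A2).
Local Notation lev := (level A1 A2).
Lemma vieta : C1 = (A1 + A2 - D) / r ^ 2 /\ C2 = (D * (A1 + A2) - A1 * A2) / r ^ 2.
Proof.
assert (h1 : C1 = (A1 + A2 - D) / r ^ 2).
(* [A2] times the first root equation minus [A1] times the second eliminates [C2]. *)
{ apply (Rmult_eq_reg_l (A1 * A2 * (A1 - A2))).
  2: { apply Rgt_not_eq; repeat apply Rmult_lt_0_compat; lra. }
  transitivity (A2 * (A1 ^ 3 / r ^ 2 + 4) - A1 * (A2 ^ 3 / r ^ 2 + 4)).
  - replace (A1 ^ 3 / r ^ 2 + 4) with (C1 * A1 ^ 2 + C2 * A1) by lra.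
    replace (A2 ^ 3 / r ^ 2 + 4) with (C1 * A2 ^ 2 + C2 * A2) by lra.
    ring.
  - unfold third_root; field; lra. }
split; [exact h1 | ].
apply (Rmult_eq_reg_l A1); [ | lra].
transitivity (A1 ^ 3 / r ^ 2 - C1 * A1 ^ 2 + 4); [lra | ].
rewrite h1; unfold third_root; field; lra.
Qed.

(** Squared length of the Killing field where [B = b]: the first integral plus [4 / b], hence
    positive between the roots. *)
Definition axial_sq (b : R) : R := C2 - b ^ 2 / r ^ 2 + C1 * b.

Lemma first_integral_factored (b : R) : b <> 0 ->
  C2 - b ^ 2 / r ^ 2 - 4 * / b + C1 * b
  = (A1 - b) * (b - A2) * (b + D) / (r ^ 2 * b).
Proof.
intros hb; destruct vieta as [-> ->]; unfold third_root; field; lra.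
Qed.

Lemma axial_sq_pos (b : R) : A2 <= b <= A1 -> 0 < axial_sq b.
Proof.
intros hb.
replace (axial_sq b) with ((A1 - b) * (b - A2) * ((b + D) / (r ^ 2 * b)) + 4 / b).
- apply Rplus_le_lt_0_compat.
  + apply Rmult_le_pos; [apply Rmult_le_pos; lra | ].
    apply Rlt_le, speed_sq_pos; lra.
  + apply Rdiv_lt_0_compat; lra.
- unfold axial_sq.
  transitivity ((A1 - b) * (b - A2) * (b + D) / (r ^ 2 * b) + 4 * / b).
  + field; lra.
  + rewrite <- first_integral_factored; lra.
Qed.

Definition angular_speed (b : R) : R := Rpower b (- 1 / 2) / axial_sq b.

Lemma ex_derive_angular_speed (b : R) : A2 <= b <= A1 -> ex_derive angular_speed b.
Proof.
intros hb; pose proof (axial_sq_pos b hb) as h.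
unfold angular_speed, axial_sq, Rpower in *; auto_derive.
repeat split; [lra | revert h; simpl; lra].
Qed.

Local Notation half_turn := (RInt (fun u => angular_speed (lev u) / spd (lev u)) 0 PI).

Lemma is_RInt_gen_progression :
  is_RInt_gen (progression_integrand r C1 C2) (at_right A2) (at_left A1) half_turn.
Proof.
generalize (is_RInt_gen_between_roots r A1 A2 hr hA2 hA _ ex_derive_angular_speed).
apply is_RInt_gen_ext.
generalize (filter_prod_between_roots A1 A2 hA); apply filter_imp; intros ab h b hb.
assert (hb' : A2 < b < A1) by (apply h; lra).
unfold progression_integrand, angular_speed.
rewrite <- first_integral_factored by lra.
unfold axial_sq, Rdiv; rewrite Rinv_mult; apply Rmult_assoc.
Qed.

Variable x : R -> vec.
Hypotheses (hx : extremal_curve r C1 x) (hC2 : first_integral r C1 C2 x).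

Local Notation B := (Bfun r x).
Local Notation bet := (cbrt_kappa r x).

Lemma dot_Jfield (s : R) : dot (Jfield r x s) (Jfield r x s) = axial_sq (B s).
Proof.
replace (Jfield r x s) with
  (plus (scal (Derive B s) (normal r x s))
     (plus (scal (- 2 * bet s) (tangent x s)) (scal 0 (x s)))).
2: { unfold Jfield, cbrt_kappa; apply vec_ext; vcoords; ring. }
rewrite (dot_frame_combination r x hr (proj1 hx)), (hC2 s); unfold axial_sq.
pose proof (Bfun_eq r x s) as hB; pose proof (cbrt_kappa_pos r x s) as hb.
rewrite hB; field; lra.
Qed.

(** The first integral cancels every term that depends on [B]. *)
Lemma dot_killing_vector (s : R) :
  dot (killing_vector r C1 x s) (killing_vector r C1 x s) = C2 / r ^ 2 + C1 ^ 2 / 4.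
Proof.
unfold killing_vector; rewrite (dot_frame_combination r x hr (proj1 hx)).
replace ((- (Derive B s / r)) ^ 2) with (Derive B s ^ 2 / r ^ 2) by (field; lra).
rewrite (hC2 s).
pose proof (Bfun_eq r x s) as hB; pose proof (cbrt_kappa_pos r x s) as hb.
rewrite hB; field; lra.
Qed.

(** The coefficient of the normal never vanishes, since [bet] is positive. *)
Lemma killing_vector_pos (s : R) :
  0 < dot (killing_vector r C1 x s) (killing_vector r C1 x s).
Proof.
unfold killing_vector; rewrite (dot_frame_combination r x hr (proj1 hx)).
pose proof (cbrt_kappa_pos r x s) as hb.
assert (h : 0 < 2 / r * bet s) by (apply Rmult_lt_0_compat; [apply Rdiv_lt_0_compat | ]; lra).
set (m := (C1 / 2 - B s / r ^ 2) / r); clearbody m.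
set (q := Derive B s / r); clearbody q.
nra.
Qed.

Lemma dot_Jfield_tangent (s : R) : dot (Jfield r x s) (tangent x s) = - 2 * bet s.
Proof.
transitivity (- 2 * bet s * dot (tangent x s) (tangent x s)
  + Derive B s * dot (normal r x s) (tangent x s)).
- unfold Jfield, cbrt_kappa; coords; ring.
- rewrite (dot_TT r x (proj1 hx)), dot_epsT; ring.
Qed.

Lemma phase_of_curve :
  exists phi, (forall s, is_derive phi s (spd (B s))) /\ forall s, B s = lev (phi s).
Proof.
apply (phase_lift r A1 A2 hr hA2 hA B (Derive B)).
- apply Bfun_pos.
- apply (is_derive_Bfun r C1 x hr hx).
- intros s; apply (is_derive_value _ _ _ _ (is_derive_dBfun r C1 x hr hx s)).
  destruct vieta as [h _]; rewrite h at 1; pose proof (Bfun_pos r x s).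
  field; lra.
- intros s; rewrite (hC2 s); apply first_integral_factored.
  apply Rgt_not_eq, Bfun_pos.
Qed.

Lemma rotation_vector_killing (s : R) : rotation_vector r x (killing_vector r C1 x s).
Proof.
split.
- intros h; generalize (killing_vector_pos s); rewrite h; coords; lra.
- intros t; rewrite (killing_vector_constant r C1 x hr hx s t).
  apply (Jfield_killing_vector r C1 x hr hx).
Qed.

(** * Azimuth about the axis of the Killing field *)

Section Azimuth.

Variables (phi : R -> R) (w e1 e2 : vec).
Hypotheses (hphi : forall s, is_derive phi s (spd (B s)))
  (hB : forall s, B s = lev (phi s))
  (hw : rotation_vector r x w)
  (he : orthonormal_basis_of_orthogonal w e1 e2).

Local Notation lam := (dot w (cross e1 e2)).
Local Notation X s := (dot (x s) e1).
Local Notation Y s := (dot (x s) e2).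
Local Notation dX s := (dot (tangent x s) e1).
Local Notation dY s := (dot (tangent x s) e2).

Lemma Bfun_bounds (s : R) : A2 <= B s <= A1.
Proof. rewrite hB; now apply level_bounds. Qed.

Lemma Jfield_plane (s : R) :
  Jfield r x s = scal lam (minus (scal (X s) e2) (scal (Y s) e1)).
Proof.
destruct hw as [_ h]; rewrite h; now apply cross_in_orthogonal_plane.
Qed.

Lemma axial_distance (s : R) : lam ^ 2 * (X s ^ 2 + Y s ^ 2) = axial_sq (B s).
Proof.
rewrite <- dot_Jfield, Jfield_plane.
destruct he as [h1 [h2 [h3 _]]].
transitivity (lam ^ 2 * (X s ^ 2 * dot e2 e2 + Y s ^ 2 * dot e1 e1
  - 2 * X s * Y s * dot e1 e2)).
- rewrite h1, h2, h3; ring.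
- set (l := lam); set (a := dot (x s) e1); set (b := dot (x s) e2).
  clearbody l a b; coords; ring.
Qed.

(** Both sides are the product of the Killing field with the tangent, computed in the plane
    orthogonal to the axis and in the moving frame. *)
Lemma areal_velocity (s : R) : lam * (X s * dY s - Y s * dX s) = - 2 * bet s.
Proof.
rewrite <- dot_Jfield_tangent, Jfield_plane.
set (l := lam); set (a := dot (x s) e1); set (b := dot (x s) e2).
clearbody l a b; coords; ring.
Qed.

Lemma lam_nonzero : lam <> 0.
Proof.
intros h; generalize (axial_distance 0) (axial_sq_pos _ (Bfun_bounds 0)).
rewrite h; lra.
Qed.

Lemma axial_distance_pos (s : R) : 0 < X s ^ 2 + Y s ^ 2.
Proof.
pose proof (axial_distance s) as h; pose proof (axial_sq_pos _ (Bfun_bounds s)) as h'.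
pose proof (pow2_ge_0 (X s)); pose proof (pow2_ge_0 (Y s)).
destruct (Req_dec (X s ^ 2 + Y s ^ 2) 0) as [h0 | h0]; [ | lra].
rewrite h0 in h; lra.
Qed.

Definition azimuth_model (s : R) : R :=
  - 2 * lam * RInt (fun u => angular_speed (lev u) / spd (lev u)) 0 (phi s).

(** The quotient of [areal_velocity] by [axial_distance] gives the angular velocity
    [- 2 * lam * bet / axial_sq B]. *)
Lemma is_derive_azimuth_model (s : R) :
  is_derive azimuth_model s ((X s * dY s - Y s * dX s) / (X s ^ 2 + Y s ^ 2)).
Proof.
apply (is_derive_value _ _ (- 2 * lam * angular_speed (B s))).
- apply (is_derive_scal
    (fun s => RInt (fun u => angular_speed (lev u) / spd (lev u)) 0 (phi s))).
  now apply (is_derive_RInt_phi r A1 A2 hr hA2 hA B phi hphi hB _ ex_derive_angular_speed).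
- pose proof (axial_distance_pos s) as h1; pose proof lam_nonzero as h2.
  unfold angular_speed; rewrite <- axial_distance; fold (bet s).
  apply (Rmult_eq_reg_l (lam * (X s ^ 2 + Y s ^ 2))).
  2: { apply Rmult_integral_contrapositive; split; lra. }
  transitivity (- 2 * bet s); [field; split; lra | ].
  rewrite <- areal_velocity; field; lra.
Qed.

Lemma azimuth_model_offset :
  exists t0, azimuth e1 e2 x (fun s => azimuth_model s + t0).
Proof.
assert (hv : forall e s, is_derive (fun t => dot (x t) e) s (dot (tangent x s) e)).
{ intros e s; eapply is_derive_value.
  - apply (is_derive_dot x (fun _ => e)); [apply (is_vderive_position r x (proj1 hx)) | ].
    apply is_vderive_const.
  - coords; ring. }
destruct (polar_lift (fun s => X s) (fun s => Y s) (fun s => dX s)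
  (fun s => dY s) azimuth_model (hv e1) (hv e2) axial_distance_pos is_derive_azimuth_model) as [t0 ht].
exists t0; split.
- intros s; apply (continuous_plus azimuth_model (fun _ => t0)).
  + apply (ex_derive_continuous azimuth_model); eexists; apply is_derive_azimuth_model.
  + apply continuous_const.
- intros s; exists (sqrt (X s ^ 2 + Y s ^ 2)); split.
  + apply sqrt_lt_R0, axial_distance_pos.
  + apply ht.
Qed.

Lemma azimuth_increment (theta : R -> R) (a b : R) :
  azimuth e1 e2 x theta -> theta b - theta a = azimuth_model b - azimuth_model a.
Proof.
intros [hc hp]; destruct azimuth_model_offset as [t0 [hc' hp']].
transitivity ((azimuth_model b + t0) - (azimuth_model a + t0)); [ | ring].
(* The radius in [azimuth] is only asserted to exist at each point; here it is identified with the
   distance to the axis, so that both angles use the same radius function. *)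
assert (norm : forall th, (forall s, exists rho, 0 < rho /\
    X s = rho * cos (th s) /\ Y s = rho * sin (th s)) ->
  forall s, X s = sqrt (X s ^ 2 + Y s ^ 2) * cos (th s) /\
    Y s = sqrt (X s ^ 2 + Y s ^ 2) * sin (th s)).
{ intros th h s; destruct (h s) as [rho [h1 [h2 h3]]].
  replace (X s ^ 2 + Y s ^ 2) with (rho²).
  - rewrite sqrt_Rsqr by lra; split; assumption.
  - rewrite h2, h3; transitivity (rho ^ 2 * ((sin (th s))² + (cos (th s))²)).
    + rewrite sin2_cos2; unfold Rsqr; ring.
    + unfold Rsqr; ring. }
assert (hs : forall s, 0 < sqrt (X s ^ 2 + Y s ^ 2)).
{ intros s; apply sqrt_lt_R0, axial_distance_pos. }
exact (polar_angle_unique (fun s => X s) (fun s => Y s) _ _ theta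
  (fun s => azimuth_model s + t0) hs hs
  (norm theta hp) (norm _ hp') hc hc' a b).
Qed.

End Azimuth.

Lemma half_turn_nonneg : 0 <= half_turn.
Proof.
pose proof (continuous_over_speed r A1 A2 hr hA2 hA _ ex_derive_angular_speed) as hc.
apply RInt_ge_0; [generalize PI_RGT_0; lra | | ].
- apply (ex_RInt_continuous (fun u => angular_speed (lev u) / spd (lev u))); intros; apply hc.
- intros u _; apply Rlt_le, Rdiv_lt_0_compat.
  + apply Rdiv_lt_0_compat; [apply exp_pos | ].
    apply axial_sq_pos, level_bounds, hA.
  + now apply spd_level_pos.
Qed.

Lemma progression_angle_eq :
  is_progression_angle r x (2 * sqrt (4 * C2 / r ^ 2 + C1 ^ 2) * half_turn).
Proof.
destruct phase_of_curve as [phi [hphi hB]].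
pose proof (least_period_travel_time r A1 A2 hr hA2 hA B phi hphi hB) as hP.
split.
- pose proof (rotation_vector_killing 0) as hw.
  (* The Killing field at the starting point is nonzero and, being a cross product with the axis
     vector, orthogonal to it. *)
  destruct (orthonormal_basis_exists (killing_vector r C1 x 0) (Jfield r x 0))
    as [e1 [e2 he]].
  + apply killing_vector_pos.
  + rewrite dot_Jfield; apply axial_sq_pos, (Bfun_bounds phi hB).
  + rewrite (Jfield_killing_vector r C1 x hr hx); coords; ring.
  + destruct (azimuth_model_offset phi _ e1 e2 hphi hB hw he) as [t0 ht].
    exists (travel_time r A1 A2 (2 * PI)), (killing_vector r C1 x 0), e1, e2.
    eexists; split; [exact hP | split; [exact hw | split; [exact he | exact ht]]].
- intros P w e1 e2 theta [hP' [hw [he ht]]] s0.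
  assert (hPP : P = travel_time r A1 A2 (2 * PI)).
  { destruct hP as [p1 [p2 p3]], hP' as [q1 [q2 q3]].
    apply Rle_antisym; [now apply q3 | now apply p3]. }
  rewrite (azimuth_increment phi w e1 e2 hphi hB hw he theta _ _ ht); unfold azimuth_model.
  rewrite <- Rmult_minus_distr_l, hPP,
    (RInt_phi_over_period r A1 A2 hr hA2 hA B phi hphi hB _ ex_derive_angular_speed).
  set (lam := dot w (cross e1 e2)).
  (* The radicand is four times the squared length of the rotation vector, so its root is
     [2 * Rabs lam]; the absolute value removes the dependence on the orientation of the basis. *)
  replace (4 * C2 / r ^ 2 + C1 ^ 2) with ((2 * lam)²).
  + rewrite sqrt_Rsqr_abs, !Rabs_mult, (Rabs_right half_turn), (Rabs_left (- 2)),
      (Rabs_right 2) by (generalize half_turn_nonneg; lra).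
    ring.
  + transitivity (4 * dot w w).
    * rewrite (dot_in_orthogonal_plane w e1 e2 he); unfold lam, Rsqr; ring.
    * rewrite (killing_vector_unique r C1 x hr hx w 0 hw), dot_killing_vector.
      field; lra.
Qed.

End Progression.

Theorem theorem5p4 (r C1 C2 A1 A2 : R) (x : R -> vec)
  (hr : 0 < r)
  (hx : extremal_curve r C1 x)
  (hC2 : first_integral r C1 C2 x)
  (hB : exists s1 s2 : R, Bfun r x s1 <> Bfun r x s2)
  (hA2 : 0 < A2) (hA : A2 < A1)
  (hroot1 : A1 ^ 3 / r ^ 2 - C1 * A1 ^ 2 - C2 * A1 + 4 = 0)
  (hroot2 : A2 ^ 3 / r ^ 2 - C1 * A2 ^ 2 - C2 * A2 + 4 = 0) :
  ex_RInt_gen (progression_integrand r C1 C2) (at_right A2) (at_left A1) /\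
  is_progression_angle r x
    (2 * sqrt (4 * C2 / r ^ 2 + C1 ^ 2) *
     RInt_gen (progression_integrand r C1 C2) (at_right A2) (at_left A1)).
Proof.
pose proof (is_RInt_gen_progression r C1 C2 A1 A2 hr hA2 hA hroot1 hroot2) as hI.
split; [eexists; exact hI | ].
rewrite (is_RInt_gen_unique _ _ hI).
exact (progression_angle_eq r C1 C2 A1 A2 hr hA2 hA hroot1 hroot2 x hx hC2).
Qed.
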